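(* Let $X=\mathcal{D}^{\mathbb{Z}}$ be a Bernoulli shift on a finite alphabet $\mathcal{D}$, let $T$ be the left shift, and let $\mu$ be the associated Bernoulli measure. Endow $X$ with the generator $\mathcal{E}=\{E_d\}_{d\in\mathcal{D}}$, where $E_d=\{x\in X:x_0=d\}$. Then the set of all $x\in X$ such that $$\alpha_{C_k(x)}\left(\frac1k\sum_{i=0}^{k-1}T^i f\right)\;\xrightarrow{k\to\infty}\;\int f\,\mathrm{d}\mu\quad\text{for all } f\in C(X)$$ is of full $\mu$-measure.
   Context: The left shift is $(Tx)_n=x_{n+1}$, and $T^if=f\circ T^i$. The Bernoulli measure $\mu$ is the product Borel probability measure on $\mathcal{D}^{\mathbb{Z}}$ induced by a probability vector $\mathbf{p}=(p(d))_{d\in\mathcal{D}}$. $C(X)$ is the space of complex-valued continuous functions. $C_k(x)=\bigcap_{i=0}^{k-1}T^{-i}E_{x_i}=\{y\in X:y_j=x_j\text{ for }0\le j\le k-1\}$. For measurable $F$ with $\mu(F)>0$, $\alpha_F(f)=\frac1{\mu(F)}\int_Ff\,\mathrm{d}\mu$. For almost every $x$, $\mu(C_k(x))>0$ for all $k$, so the expressions are defined almost everywhere. *)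

(* Defs.v *)
From HB Require Import structures.
From mathcomp Require Import all_boot all_order all_algebra.
From mathcomp Require Import complex.
From mathcomp Require Import all_classical all_reals all_analysis.
Import Order.TTheory GRing.Theory Num.Theory.
Import numFieldNormedType.Exports.

Set Implicit Arguments.
Unset Strict Implicit.
Unset Printing Implicit Defensive.

Local Open Scope classical_set_scope.
Local Open Scope ring_scope.

(* Nonempty finite alphabets: the distinguished point is only there because
   [measurableType] requires a pointed carrier. *)
#[short(type="pfinType")]
HB.structure Definition PointedFinite := {T of Finite T & Pointed T}.

(* D^Z with the product of the discrete topologies. *)
Definition fullshift (D : pfinType) : Type :=
  prod_topology (fun _ : int => discrete_topology D).

HB.instance Definition _ (D : pfinType) :=
  Topological.copy (fullshift D)
    (prod_topology (fun _ : int => discrete_topology D)).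
HB.instance Definition _ (D : pfinType) :=
  isPointed.Build (fullshift D) (fun=> point).

Notation borel_fullshift D := (g_sigma_algebraType (@open (fullshift D))).

Section Bernoulli.
Context {R : realType} {D : pfinType}.
Implicit Types (p : D -> R) (mu : probability (borel_fullshift D) R).

Definition is_probability_vector p : Prop :=
  (forall d, 0 <= p d) /\ \sum_d p d = 1.

(* The product measure of [p], through its values on measurable rectangles,
   which determine it. *)
Definition is_bernoulli_measure p mu : Prop :=
  forall (s : seq int) (A : int -> {set D}), uniq s ->
    mu [set x : fullshift D | forall n : int, n \in s -> x n \in A n]
    = (\prod_(n <- s) \sum_(d in A n) p d)%:E.

End Bernoulli.

Section Shift.
Context {D : pfinType}.

Definition left_shift (x : fullshift D) : fullshift D := fun n => x (n + 1).

Definition gen (d : D) : set (fullshift D) := [set x | x 0 = d].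

Definition cylinder (k : nat) (x : fullshift D) : set (fullshift D) :=
  \bigcap_(i in [set i : nat | (i < k)%N])
    (iter i left_shift @^-1` gen (x i%:Z)).

End Shift.

(* [R[i]^o] is [R[i]] carrying the topology of its modulus. *)
Notation Cplx R := (complex R)^o.

Section ComplexIntegral.
Context {R : realType} {D : pfinType}.
Variable mu : probability (borel_fullshift D) R.

Definition Cintegral (F : set (fullshift D)) (f : fullshift D -> Cplx R) :
    Cplx R :=
  Complex (\int[mu]_(x in F) complex.Re (f x)) (\int[mu]_(x in F) complex.Im (f x)).

(* Meaningful when [0 < mu F]. *)
Definition alpha (F : set (fullshift D)) (f : fullshift D -> Cplx R) : Cplx R :=
  (Complex (fine (mu F)) 0)^-1 * Cintegral F f.

Definition birkhoff_average (k : nat) (f : fullshift D -> Cplx R) :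
    fullshift D -> Cplx R :=
  fun x => k%:R^-1 * \sum_(i < k) f (iter i left_shift x).

End ComplexIntegral.

(* Main.v *)
Require Import Defs.
From mathcomp Require Import all_boot all_order all_algebra.
From mathcomp Require Import complex.
From mathcomp Require Import all_classical all_reals all_analysis.
From mathcomp Require Import measurable_realfun zify ring lra.
Import Order.TTheory GRing.Theory Num.Theory.
Import numFieldNormedType.Exports.
Local Open Scope classical_set_scope.
Local Open Scope ring_scope.

(* On the cylinder C_k(x) the points T^i y and T^i x agree on [-M, M] whenever
   M <= i < k - M, so by uniform continuity the average of f over C_k(x) differs
   from the Birkhoff average of f at x by o(1). It remains to see that almost
   every x has convergent Birkhoff averages for all f at once; approximating f
   uniformly by functions of finitely many coordinates, this reduces to the
   countably many frequencies of finite words. The occurrences of a word of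
   length 2M+1 at places more than 2M apart are independent, so a second-moment
   bound gives convergence along the squares, and bounded increments fill the
   gaps. *)

(** * Topology of the full shift: agreement windows, neighbourhoods, compactness *)

Section Agreement.
Context {D : pfinType}.
Implicit Types (x y z : fullshift D).

(** Plays the role of a metric: for growing [M] these relations form a base of entourages, and each
    is an equivalence relation, so its classes are clopen. *)
Definition agree (M : nat) x y := forall n : int, (absz n <= M)%N -> x n = y n.

Lemma agree_sym M x y : agree M x y -> agree M y x.
Proof. by move=> xy n /xy. Qed.

Lemma agree_trans M x y z : agree M x y -> agree M y z -> agree M x z.
Proof. by move=> xy yz n nM; rewrite xy// yz. Qed.

Lemma agree_le M N x y : (M <= N)%N -> agree N x y -> agree M x y.
Proof. by move=> MN xy n nM; apply/xy/(leq_trans nM). Qed.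

Lemma nbhs_coord z (n : int) : nbhs z [set y : fullshift D | z n = y n].
Proof.
have := @proj_continuous int (fun=> discrete_topology D) n z.
move=> /(_ [set d | z n = d]); apply.
by rewrite /= nbhs_principalE; exact/principal_filterP.
Qed.

Lemma nbhs_agree M z : nbhs z (agree M z).
Proof.
pose s := [seq i%:Z - M%:Z | i <- iota 0 (M.*2).+1].
suff : \forall y \near z, forall n : int, n \in s -> z n = y n.
  apply: filterS => y zy n nM; apply: zy; apply/mapP.
  exists (absz (n + M%:Z)); last lia.
  rewrite mem_iota; lia.
elim: s => [|a s IH].
  by apply: (@nearW _ (nbhs z)) => y n; rewrite in_nil.
have : \forall y \near z, z a = y a /\ forall n : int, n \in s -> z n = y n.
  by apply: filterI => //; exact: nbhs_coord.
by apply: filterS => y [ya ys] n; rewrite inE => /predU1P[->|/ys].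
Qed.

Lemma nbhs_fullshiftP z (V : set (fullshift D)) :
  nbhs z V <-> exists M, agree M z `<=` V.
Proof.
(* For the converse, the filter generated by the windows around [z] is shown to converge to [z]. The
   product topology is a supremum of coordinate topologies, so each coordinate [n] can be treated
   alone, and the window of radius [absz n] fixes it. *)
split; last by move=> [M MV]; apply: filterS MV _; exact: nbhs_agree.
pose F := filter_from [set: nat] (fun M => agree M z).
have FF : Filter F.
  apply: filter_from_filter; first by exists 0%N.
  move=> M N _ _; exists (maxn M N) => // y zy.
  by split; apply: agree_le zy; rewrite ?leq_maxl ?leq_maxr.
suff Fz : F --> z.
  by move=> /Fz[M _ MV]; exists M.
apply/cvg_sup => n A.
rewrite nbhsE => -[B [[C Copen <-] /= Cz] BA].
exists (absz n) => // y zy; apply: BA => /=; rewrite /proj -(zy n)//.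
Qed.

Lemma fullshift_compact : compact [set: fullshift D].
Proof.
have := @tychonoff int (fun=> discrete_topology D) (fun=> setT).
rewrite (_ : [set f : forall i, _ | _] = setT); last by apply/seteqP.
apply=> n; apply: finite_compact.
exact: (@finite_finset D).
Qed.
End Agreement.

(** * Continuous real functions, measurability, and iterates of the shift *)

Section Continuity.
Context {D : pfinType} {R : realType}.

(** Heine-Cantor: near each [z] a window radius [N] keeps [u] within [e / 2] of [u z], any [M >= N]
    then serves all points of that neighbourhood, and compactness selects one [M] for the whole
    space. *)
Lemma continuous_fullshift_unif (u : fullshift D -> R) (e : R) :
  continuous u -> 0 < e ->
  exists M, forall x y, agree M x y -> `|u x - u y| <= e.
Proof.
move=> cu e0.
have /compact_near_coveringP cov := @fullshift_compact D.
have /cov : forall z : fullshift D, [set: fullshift D] z ->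
    \forall x \near z & M \near \oo, forall y, agree M x y -> `|u x - u y| <= e.
  move=> z _.
  have : nbhs z (u @^-1` ball (u z) (e / 2)).
    by apply: cu; apply: nbhsx_ballx; rewrite divr_gt0.
  move=> /nbhs_fullshiftP[N zN].
  exists (agree N z, [set M | (N <= M)%N]).
    by split; [exact: nbhs_agree|exists N].
  move=> [x M] /= [zx NM] y xy.
  have /zN := zx; have /zN : agree N z y.
    by apply: agree_trans zx _; apply: agree_le xy.
  rewrite /ball/= => uzy uzx.
  rewrite -(subrKA (u z)) (le_trans (ler_normD _ _))// (splitr e) lerD// ltW//.
  by rewrite distrC.
move=> [M _ H]; exists M => x y xy; exact: (H M (leqnn M) x _ y xy).
Qed.

Lemma continuous_fullshift_bounded (u : fullshift D -> R) :
  continuous u -> exists2 B, 0 <= B & forall x, `|u x| <= B.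
Proof.
move=> cu; have := @continuous_compact _ _ u setT.
move=> /(_ (continuous_subspaceT cu) fullshift_compact).
move=> /compact_bounded[B [_ H]].
exists (`|B| + 1); first by rewrite addr_ge0.
by move=> x; apply: (H (`|B| + 1)); [rewrite ltr_pwDr// ler_norm|exists x].
Qed.

Lemma continuous_borel_measurable (u : fullshift D -> R) :
  continuous u -> measurable_fun [set: borel_fullshift D] u.
Proof.
move=> cu.
apply: (measurability _ (RGenOpens.measurableE R)) => _ [_ [a [b ->]] <-].
rewrite setTI; apply: sub_sigma_algebra.
by move/continuousP : cu; apply; exact: interval_open.
Qed.

Lemma measurable_coord (n : int) (A : set D) :
  measurable ([set x : fullshift D | A (x n)] : set (borel_fullshift D)).
Proof.
apply: sub_sigma_algebra; rewrite openE => z Az.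
by have := nbhs_coord z n; apply: filterS => y /= <-.
Qed.

Lemma measurable_agree M z :
  measurable (agree M z : set (borel_fullshift D)).
Proof.
apply: sub_sigma_algebra; rewrite openE => y zy.
apply/nbhs_fullshiftP; exists M.
by move=> w; exact: agree_trans.
Qed.

Lemma iter_left_shift i (x : fullshift D) n :
  iter i left_shift x n = x (n + i%:Z).
Proof.
elim: i n => [|i IH] n; first by rewrite addr0.
by rewrite iterS /left_shift IH; congr (x _); lia.
Qed.

Lemma agree_iter i M (x y : fullshift D) : agree (M + i) x y ->
  agree M (iter i left_shift x) (iter i left_shift y).
Proof. move=> xy n nM; rewrite !iter_left_shift; apply: xy; lia. Qed.

Lemma continuous_iter_left_shift i :
  continuous (iter i left_shift : fullshift D -> fullshift D).
Proof.
move=> x V /nbhs_fullshiftP[M MV]; apply/nbhs_fullshiftP.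
by exists (M + i)%N => y xy; exact/MV/agree_iter.
Qed.

Lemma cylinderP k (x y : fullshift D) :
  cylinder k x y <-> (forall i : nat, (i < k)%N -> y i%:Z = x i%:Z).
Proof.
split=> H i /H; rewrite /gen /preimage /= iter_left_shift add0r//.
Qed.

End Continuity.

(** * Passing from squares to all indices, and summing inverse squares *)

Section RealSequences.
Context {R : realType}.

Lemma sqrt_floor (k : nat) : exists n, (n ^ 2 <= k < n.+1 ^ 2)%N.
Proof.
elim: k => [|k [n /andP[nk kn]]]; first by exists 0%N.
have [h|h] := ltnP k.+1 (n.+1 ^ 2); first by exists n; rewrite h andbT; lia.
by exists n.+1; rewrite h/= !expnS !expn0 in kn *; nia.
Qed.

(** If [n ^ 2 <= k < n.+1 ^ 2], then [a k] differs from [a (n ^ 2)] by at most [2 * n], which is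
    negligible against [n ^ 2]. *)
Lemma cvg_mean_squares (a : nat -> R) :
  (forall k, `|a k.+1 - a k| <= 1) ->
  (a (n ^ 2)%N / (n ^ 2)%:R) @[n --> \oo] --> 0 ->
  (a k / k%:R) @[k --> \oo] --> 0.
Proof.
move=> a1 /cvgrPdist_le a2; apply/cvgrPdist_le => e e0.
have e20 : 0 < e / 2 by rewrite divr_gt0.
have [N _ HN] := a2 _ e20.
have aD k m : `|a (k + m)%N| <= `|a k| + m%:R.
  elim: m => [|m IH]; first by rewrite addn0 addr0.
  rewrite addnS -(subrK (a (k + m)%N) (a _.+1)) (le_trans (ler_normD _ _))//.
  by rewrite -natr1; have := a1 (k + m)%N; lra.
(* The three demands on [n]: beyond [N] the averages along squares are small, [n] is positive, and
   [n >= 4 / e] makes the gap [2 * n] at most [e / 2 * n ^ 2]. *)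
pose N1 := maxn (maxn N 1) (Num.truncn (4 / e)).+1.
exists (N1 ^ 2)%N => // k /= Nk.
have [n /andP[nk kn]] := sqrt_floor k.
have N1n : (N1 <= n)%N.
  by rewrite -ltnS -(ltn_exp2r _ _ (isT : (0 < 2)%N)); exact: leq_ltn_trans kn.
have n0 : (0 < n)%N by apply: leq_trans N1n; rewrite /N1 !leq_max orbT.
have nR : 0 < (n%:R : R) by rewrite ltr0n.
have kR : 0 < (k%:R : R).
  by rewrite ltr0n; apply: leq_trans nk; rewrite expn_gt0 n0.
have : (N <= n)%N by apply: leq_trans N1n; rewrite /N1 !leq_max leqnn.
move=> /HN; rewrite !sub0r !normrN !normf_div !normr_nat.
rewrite ler_pdivrMr ?ltr0n ?expn_gt0 ?n0// ler_pdivrMr// => an.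
have en : 2 <= e / 2 * n%:R.
  have : 4 / e <= n%:R.
    apply: ltW; apply: (lt_le_trans (truncnS_gt _)); rewrite ler_nat.
    by apply: leq_trans N1n; rewrite /N1 leq_max leqnn orbT.
  by rewrite ler_pdivrMr// => h; lra.
have -> : k = (n ^ 2 + (k - n ^ 2))%N by lia.
apply: (le_trans (aD _ _)); rewrite natrD mulrDr.
have : ((k - n ^ 2)%N%:R : R) <= e / 2 * (n ^ 2)%:R.
  apply: (@le_trans _ _ (2 * n%:R)).
    by rewrite -natrM ler_nat; move: kn; clear; nia.
  by rewrite expnS expn1 natrM mulrA ler_wpM2r// ltW.
have : 0 <= ((k - n ^ 2)%N%:R : R) by [].
have := mulr_ge0 (ltW e0) (ler0n R (k - n ^ 2)).
by lra.
Qed.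

Lemma sum_inv_squares_le n :
  \sum_(i < n) ((i.+1 ^ 2)%:R)^-1 <= 2 - n%:R^-1 :> R.
Proof.
elim: n => [|n IH]; first by rewrite big_ord0 invr0 subr0.
(* The first term is checked by hand: as [0^-1 = 0], the bound for the empty sum is 2, too weak to
   start the induction. From the second term on, [1/(n+2)^2 <= 1/(n+1) - 1/(n+2)] telescopes. *)
rewrite big_ord_recr/=; case: n IH => [|n] IH.
  by rewrite big_ord0/= exp1n invr1; lra.
apply: (le_trans (lerD IH (lexx _))).
suff : ((n.+2 ^ 2)%:R)^-1 <= n.+1%:R^-1 - n.+2%:R^-1 :> R.
  by move=> h; rewrite (le_trans (lerD (lexx _) h))// addrA subrK.
have -> : n.+1%:R^-1 - n.+2%:R^-1 = (n.+1 * n.+2)%:R^-1 :> R.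
  have h1 : n.+1%:R != 0 :> R by rewrite pnatr_eq0.
  have h2 : n.+2%:R != 0 :> R by rewrite pnatr_eq0.
  have h3 : n.+2%:R = n.+1%:R + 1 :> R by rewrite natr1.
  rewrite natrM h3; rewrite h3 in h2; move: (n.+1%:R : R) h1 h2 => x h1 h2.
  by field; rewrite h1 h2.
by rewrite lef_pV2 ?posrE ?ltr0n ?muln_gt0 ?expn_gt0// ler_nat leq_mul2r leqnSn.
Qed.

End RealSequences.

(** * Bounded measurable functions on a probability space *)

Section BoundedMeasurable.
Context d (T : measurableType d) (R : realType) (mu : probability T R).
Implicit Types f g : T -> R.

(** A class closed under sums and products and contained in the integrable functions; integrability
    itself would not pass to products. *)
Definition bounded_measurable f : Prop :=
  measurable_fun setT f /\ exists B, forall x, `|f x| <= B.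

Lemma bounded_measurable_cst (c : R) : bounded_measurable (fun=> c).
Proof. by split; [exact: measurable_cst|exists `|c|]. Qed.

Lemma bounded_measurableD f g : bounded_measurable f -> bounded_measurable g ->
  bounded_measurable (fun x => f x + g x).
Proof.
move=> [mf [B fB]] [mg [C gC]]; split; first exact: measurable_funD.
by exists (B + C) => x; rewrite (le_trans (ler_normD _ _))// lerD.
Qed.

Lemma bounded_measurableM f g : bounded_measurable f -> bounded_measurable g ->
  bounded_measurable (fun x => f x * g x).
Proof.
move=> [mf [B fB]] [mg [C gC]]; split; first exact: measurable_funM.
by exists (B * C) => x; rewrite normrM ler_pM.
Qed.

Lemma bounded_measurableN f : bounded_measurable f ->
  bounded_measurable (fun x => - f x).
Proof.
move=> [mf [B fB]]; split; first exact: measurableT_comp.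
by exists B => x; rewrite normrN.
Qed.

Lemma bounded_measurableB f g : bounded_measurable f -> bounded_measurable g ->
  bounded_measurable (fun x => f x - g x).
Proof.
by move=> bf bg; apply: bounded_measurableD => //; exact: bounded_measurableN.
Qed.

Lemma bounded_measurable_sum I (s : seq I) (F : I -> T -> R) :
  (forall i, bounded_measurable (F i)) ->
  bounded_measurable (fun x => \sum_(i <- s) F i x).
Proof.
move=> bF; elim: s => [|i s IH].
  by under eq_fun do rewrite big_nil; exact: bounded_measurable_cst.
by under eq_fun do rewrite big_cons; exact: bounded_measurableD.
Qed.

Lemma bounded_measurable_indic (A : set T) : measurable A ->
  bounded_measurable (\1_A : T -> R).
Proof.
move=> mA; split; first exact: measurable_indic.
by exists 1 => x; rewrite indicE ger0_norm// lern1 leq_b1.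
Qed.

Lemma bounded_measurable_integrable (A : set T) f : measurable A ->
  bounded_measurable f -> mu.-integrable A (EFin \o f).
Proof.
move=> mA [mf [B fB]]; apply: measurable_bounded_integrable => //.
- by rewrite (le_lt_trans (probability_le1 _ mA))// ltry.
- exact: measurable_funTS.
- exists B; split; first exact: num_real.
  by move=> M BM x _; exact: le_trans (fB x) (ltW BM).
Qed.

Lemma Rintegral_sum I (s : seq I) (F : I -> T -> R) (A : set T) :
  measurable A ->
  (forall i, bounded_measurable (F i)) ->
  \int[mu]_(x in A) (\sum_(i <- s) F i x) =
  \sum_(i <- s) \int[mu]_(x in A) F i x.
Proof.
move=> mA bF; elim: s => [|i s IH].
  under eq_Rintegral do rewrite big_nil.
  by rewrite big_nil Rintegral_cst// mul0r.
under eq_Rintegral do rewrite big_cons.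
rewrite big_cons RintegralD ?IH//; apply: bounded_measurable_integrable => //.
exact: bounded_measurable_sum.
Qed.

End BoundedMeasurable.

(** * A strong law for bounded variables uncorrelated beyond lag [L] *)

Lemma card_near_le (L i n : nat) :
  (\sum_(j < n | (j <= i + L)%N && (i <= j + L)%N) 1 <= L.*2.+1)%N.
Proof.
rewrite -(big_mkord (fun j => (j <= i + L)%N && (i <= j + L)%N) (fun=> 1%N)).
rewrite sum1_count -size_filter -(size_iota (i - L) L.*2.+1).
(* The subtraction [i - L] is truncated: when [i < L] the interval starts at 0 and its length still
   carries it past [i + L]. *)
apply: uniq_leq_size; first by rewrite filter_uniq// iota_uniq.
by move=> j; rewrite mem_filter mem_iota => /andP[/andP[jL iL] _]; lia.
Qed.

Section StrongLaw.
Context d (T : measurableType d) (R : realType) (mu : probability T R).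
Variables (phi : nat -> T -> R) (L : nat).
Hypothesis mphi : forall i, measurable_fun setT (phi i).
Hypothesis phi1 : forall i x, `|phi i x| <= 1.
Hypothesis phi0 : forall i j, (i + L < j)%N ->
  \int[mu]_x (phi i x * phi j x) = 0.

Let bphi i : bounded_measurable _ _ _ (phi i).
Proof. by split => //; exists 1. Qed.

(** Expand the square into a double sum: pairs more than [L] apart integrate to 0, the others to at
    most 1, and each [i] has at most [2L+1] partners. *)
Lemma second_moment_le n :
  \int[mu]_x ((\sum_(i < n) phi i x) ^+ 2) <= (n * L.*2.+1)%:R.
Proof.
under eq_Rintegral do rewrite expr2 big_distrlr/=.
rewrite Rintegral_sum//; last first.
  by move=> i; apply: bounded_measurable_sum => j; exact: bounded_measurableM.
rewrite -[n in leRHS](@card_ord n) -sum1_card big_distrl natr_sum/=.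
apply: ler_sum => i _; rewrite mul1n.
rewrite Rintegral_sum//; last by move=> j; exact: bounded_measurableM.
apply: (@le_trans _ _
    (\sum_(j < n | (j <= i + L)%N && (i <= j + L)%N) 1)); last first.
  by rewrite sumr_const ler_nat -sum1_card card_near_le.
rewrite [leRHS]big_mkcond/=; apply: ler_sum => j _.
have [ji|ji]/= := leqP j (i + L); last by rewrite phi0.
have [ij|ij]/= := leqP i (j + L); last first.
  by under eq_Rintegral do rewrite mulrC; rewrite phi0.
apply: (@le_trans _ _ (\int[mu]_x 1)); last first.
  by rewrite Rintegral_cst //= probability_setT mulr1.
apply: le_Rintegral => //.
- by apply: bounded_measurable_integrable => //; exact: bounded_measurableM.
- by apply: bounded_measurable_integrable => //; exact: bounded_measurable_cst.
- move=> x _; rewrite (le_trans (ler_norm _))// normrM.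
  by rewrite -[leRHS]mul1r ler_pM.
Qed.

(** Squared averages along the squares; starting from [1 ^ 2] keeps the denominators positive. *)
Let g n x := ((\sum_(i < n.+1 ^ 2) phi i x) / (n.+1 ^ 2)%:R) ^+ 2.

Let bg n : bounded_measurable _ _ _ (g n).
Proof.
rewrite /g; under eq_fun do rewrite expr2.
by apply: bounded_measurableM; apply: bounded_measurableM;
  [exact: bounded_measurable_sum|exact: bounded_measurable_cst|
   exact: bounded_measurable_sum|exact: bounded_measurable_cst].
Qed.

Let int_g n : (\int[mu]_x (g n x)%:E <= (L.*2.+1%:R * ((n.+1 ^ 2)%:R)^-1)%:E)%E.
Proof.
have ig : mu.-integrable setT (EFin \o g n).
  exact: bounded_measurable_integrable.
rewrite -[leLHS]fineK; last exact: integrable_fin_num.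
rewrite lee_fin -/(Rintegral mu setT (g n)) /g.
under eq_Rintegral do rewrite exprMn mulrC.
rewrite RintegralZl//; last first.
  apply: bounded_measurable_integrable => //.
  by under eq_fun do rewrite expr2; apply: bounded_measurableM;
    exact: bounded_measurable_sum.
have n0 : 0 < (n.+1 ^ 2)%:R :> R by rewrite ltr0n expn_gt0.
apply: (@le_trans _ _ ((n.+1 ^ 2)%:R ^- 2 * (n.+1 ^ 2 * L.*2.+1)%:R)).
  by rewrite exprVn ler_wpM2l ?second_moment_le// invr_ge0 exprn_ge0// ltW.
rewrite natrM mulrA expr2 invfM -[_ * _ * (n.+1 ^ 2)%:R]mulrA mulVf ?gt_eqF//.
by rewrite mulr1 mulrC.
Qed.

(** The integrals of the [g n] are dominated by a multiple of the inverse squares, hence summable.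
    Exchanging sum and integral of nonnegative terms makes the series integrable, so finite almost
    everywhere. *)
Let sum_g_fin : {ae mu, forall x, (\sum_(n <oo) (g n x)%:E < +oo)%E}.
Proof.
have g0 n x : (0 <= (g n x)%:E)%E by rewrite lee_fin sqr_ge0.
have mg n : measurable_fun setT (fun x => (g n x)%:E).
  by apply/measurable_EFinP; exact: (bg n).1.
have : mu.-integrable setT (fun x => \sum_(n <oo) (g n x)%:E)%E.
  apply/integrableP; split; first exact: ge0_emeasurable_sum.
  under eq_integral => x _ do rewrite gee0_abs ?nneseries_ge0//.
  rewrite integral_nneseries//.
  apply: (@le_lt_trans _ _ (L.*2.+1%:R * 2)%:E); last exact: ltry.
  apply: lime_le.
    by apply: is_cvg_nneseries => n _ _; apply: integral_ge0.
  apply: nearW => n; rewrite big_mkord.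
  apply: (@le_trans _ _ (\sum_(i < n) (L.*2.+1%:R * ((i.+1 ^ 2)%:R)^-1)%:E)%E).
    by apply: lee_sum => i _; exact: int_g.
  rewrite sumEFin lee_fin -mulr_sumr ler_wpM2l//.
  by rewrite (le_trans (sum_inv_squares_le n))// gerBl invr_ge0.
move=> /integrable_ae -/(_ measurableT); apply: filterS => x /(_ I).
by rewrite fin_numElt => /andP[].
Qed.

(** Terms of a convergent nonnegative series tend to 0, which settles the averages along squares;
    increments bounded by 1 give the remaining indices. *)
Lemma strong_law :
  {ae mu, forall x, (\sum_(i < k) phi i x) / k%:R @[k --> \oo] --> 0}.
Proof.
move: sum_g_fin; apply: filterS => x sx.
apply: (@cvg_mean_squares _ (fun k => \sum_(i < k) phi i x)).
  by move=> k; rewrite big_ord_recr/= addrAC subrr add0r.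
rewrite -(cvg_shiftS (fun n => (\sum_(i < n ^ 2) phi i x) / (n ^ 2)%:R)).
have g0 n : (0 <= (g n x)%:E)%E by rewrite lee_fin sqr_ge0.
have tl := nneseries_tail_cvg sx (fun k _ => g0 k).
apply/cvgrPdist_lt => e e0.
(* The tail from [N] dominates its first term [g N x], a square, whence the threshold [e ^+ 2]. *)
have : \forall N \near \oo, (\sum_(N <= k <oo) (g k x)%:E < (e ^+ 2)%:E)%E.
  have e2 : (0 < (e ^+ 2)%:E)%E by rewrite lte_fin exprn_gt0.
  exact: tl (open_nbhs_nbhs (conj (@open_ereal_lt_ereal R _) e2)).
apply: filterS => N HN.
have : ((g N x)%:E < (e ^+ 2)%:E)%E.
  apply: le_lt_trans HN.
  apply: le_trans (nneseries_lim_ge N.+1 _); last by [].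
  by rewrite big_nat1.
rewrite lte_fin /g sub0r normrN -real_normK ?num_real//.
by rewrite ltr_pXn2r// nnegrE// ltW.
Qed.

End StrongLaw.

(** * Occurrences of words under the Bernoulli measure and their frequencies *)

Section Words.
Context {D : pfinType}.
Implicit Types (x z : fullshift D).

(** The interval [-M, M] as a duplicate-free list, the form in which the Bernoulli property takes
    its coordinates. *)
Definition window (M : nat) : seq int :=
  [seq i%:Z - M%:Z | i <- iota 0 M.*2.+1].

Lemma mem_window M n : (n \in window M) = (absz n <= M)%N.
Proof.
apply/mapP/idP => [[j jM ->]|nM]; first by move: jM; rewrite mem_iota; lia.
by exists (absz (n + M%:Z)); [rewrite mem_iota|]; lia.
Qed.

Lemma uniq_window M : uniq (window M).
Proof. by rewrite map_inj_uniq ?iota_uniq// => i j; lia. Qed.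

Definition word_at M z (i : nat) : set (fullshift D) :=
  [set x | agree M z (iter i left_shift x)].

Lemma measurable_word_at M z i :
  measurable (word_at M z i : set (borel_fullshift D)).
Proof.
apply: sub_sigma_algebra; rewrite openE => y zy.
apply/nbhs_fullshiftP; exists (M + i)%N => w /agree_iter; exact: agree_trans.
Qed.

Let shifted M (i : nat) := [seq n + i%:Z | n <- window M].

Let mem_shifted M i n : (n \in shifted M i) = (absz (n - i%:Z)%R <= M)%N.
Proof.
rewrite /shifted -{1}[n](subrK i%:Z).
rewrite (mem_map (f := fun m => m + i%:Z)) ?mem_window//.
exact: addIr.
Qed.

Let uniq_shifted M i : uniq (shifted M i).
Proof. by rewrite map_inj_uniq ?uniq_window// => a b /addIr. Qed.

Let word_atE M z i x :
  word_at M z i x <-> (forall n, n \in shifted M i -> x n = z (n - i%:Z)).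
Proof.
split=> H n.
  by rewrite mem_shifted => /H ->; rewrite iter_left_shift subrK.
move=> nM; rewrite iter_left_shift H ?addrK//.
by rewrite mem_shifted addrK.
Qed.

Context {R : realType} (p : D -> R) (mu : probability (borel_fullshift D) R).
Hypothesis hmu : is_bernoulli_measure p mu.

Let wt M z := \prod_(n <- window M) p (z n).

(** The event is a rectangle over the window moved by [i], and its weight does not see [i]: this is
    the stationarity of [mu]. *)
Lemma mu_word_at M z i : mu (word_at M z i) = (wt M z)%:E.
Proof.
have := hmu (shifted M i) (fun n => [set z (n - i%:Z)]%SET) (uniq_shifted M i).
rewrite (_ : [set x | _] = word_at M z i); last first.
  apply/seteqP; split=> x.
    by move=> H; apply/word_atE => n /H; rewrite inE => /eqP.
  by move=> /word_atE H n /H ->; rewrite inE.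
move=> ->; rewrite big_map; congr EFin; apply: eq_bigr => n _.
by rewrite big_set1 addrK.
Qed.

(** Independence: the two moved windows are disjoint, so both occurrences together form one
    rectangle whose product splits. *)
Lemma mu_word_atI M z i j : (i + M.*2 < j)%N ->
  mu (word_at M z i `&` word_at M z j) = (wt M z * wt M z)%:E.
Proof.
move=> ij.
have disj n : n \in shifted M j -> n \in shifted M i = false.
  by rewrite !mem_shifted; lia.
pose A n := if n \in shifted M i then [set z (n - i%:Z)]%SET
            else [set z (n - j%:Z)]%SET.
have := hmu (shifted M i ++ shifted M j) A.
rewrite (_ : [set x | _] = word_at M z i `&` word_at M z j); last first.
  apply/seteqP; split=> x.
    move=> H; split; apply/word_atE => n ns;
      have := H n; rewrite mem_cat ns ?orbT.
      by rewrite /A ns => /(_ isT); rewrite inE => /eqP.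
    by rewrite /A disj// => /(_ isT); rewrite inE => /eqP.
  move=> [/word_atE Hi /word_atE Hj] n; rewrite mem_cat /A.
  by case: ifPn => [ni _|ni /= nj]; rewrite inE; [rewrite Hi|rewrite Hj].
move=> ->; last first.
  rewrite cat_uniq !uniq_shifted andbT; apply/hasPn => n nj.
  exact: negbT (disj n nj).
congr EFin; rewrite big_cat/=; congr (_ * _).
  rewrite big_map; apply: eq_big_seq => n nw.
  rewrite /A mem_shifted addrK -mem_window nw.
  by rewrite big_set1.
transitivity (\prod_(n <- shifted M j) p (z (n - j%:Z))).
  by apply: eq_big_seq => n nj; rewrite /A disj// big_set1.
by rewrite big_map; apply: eq_bigr => n _; rewrite addrK.
Qed.

(** The strong law applied to the indicators of the occurrences, centred by the weight [q] of the
    word, with lag [M.*2]. *)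
Lemma word_frequency M z : {ae mu, forall x,
  (\sum_(i < k) \1_(agree M z) (iter i left_shift x)) / k%:R @[k --> \oo]
    --> fine (mu (agree M z))}.
Proof.
have mw i : measurable (word_at M z i : set (borel_fullshift D)).
  exact: measurable_word_at.
have q01 : 0 <= wt M z <= 1.
  by rewrite -!lee_fin -(mu_word_at M z 0) measure_ge0 probability_le1.
have -> : mu (agree M z) = (wt M z)%:E by rewrite -(mu_word_at M z 0).
rewrite /=; set q := wt M z in q01 *.
pose phi i x := \1_(word_at M z i) x - q.
pose ind A : borel_fullshift D -> R := \1_A.
have bphi i : bounded_measurable _ _ _ (ind (word_at M z i)).
  exact: bounded_measurable_indic.
have iphi i : mu.-integrable setT (EFin \o ind (word_at M z i)).
  exact: bounded_measurable_integrable.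
have Eind (A : set (borel_fullshift D)) :
    measurable A -> \int[mu]_x (\1_A x) = fine (mu A).
  by move=> mA; rewrite /Rintegral integral_indic// setIT.
have := @strong_law _ (borel_fullshift D) R mu phi M.*2.
have : forall i, measurable_fun [set: borel_fullshift D] (phi i).
  by move=> i; apply: measurable_funB => //; exact: measurable_indic.
move=> mphi /(_ mphi) {mphi}.
have : forall i x, `|phi i x| <= 1.
  move=> i x; rewrite /phi indicE ler_norml; case/andP: q01 => q0 q1.
  by case: (_ \in _) => /=; apply/andP; split; lra.
move=> phi1 /(_ phi1) {phi1}.
have : forall i j, (i + M.*2 < j)%N -> \int[mu]_x (phi i x * phi j x) = 0.
  move=> i j ij.
  (* After this expansion the integral is [q * q - q * (q + q) + q * q = 0], the first term by
     independence. *)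
  have -> : (fun x => phi i x * phi j x) = (fun x =>
      \1_(word_at M z i `&` word_at M z j) x
      - q * (\1_(word_at M z i) x + \1_(word_at M z j) x) + q * q).
    by apply/funext => x; rewrite /phi indicI /=; ring.
  have i1 : mu.-integrable setT
      (EFin \o ind (word_at M z i `&` word_at M z j)).
    apply: bounded_measurable_integrable => //.
    by apply: bounded_measurable_indic; exact: measurableI.
  have b2 := bounded_measurableD _ _ _ _ _ (bphi i) (bphi j).
  have i3 : mu.-integrable setT (EFin \o
      (fun x => q * (ind (word_at M z i) x + ind (word_at M z j) x))).
    apply: bounded_measurable_integrable => //.
    by apply: bounded_measurableM => //; exact: bounded_measurable_cst.
  rewrite RintegralD//; last 2 first.
    + apply: bounded_measurable_integrable => //.
      apply: bounded_measurableD; last apply: bounded_measurableN.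
        by apply: bounded_measurable_indic; exact: measurableI.
      by apply: bounded_measurableM => //; exact: bounded_measurable_cst.
    + apply: bounded_measurable_integrable => //.
      exact: bounded_measurable_cst.
  rewrite RintegralB// RintegralZl//; last exact: bounded_measurable_integrable.
  rewrite RintegralD// Rintegral_cst// !Eind//; last exact: measurableI.
  rewrite !mu_word_at mu_word_atI// -/q /=.
  rewrite (_ : fine (mu _) = 1); last by rewrite probability_setT.
  by ring.
move=> phi0 /(_ phi0); apply: filterS => x xq.
have -> : q = 0 + q by rewrite add0r.
apply: (@cvg_trans _ (((\sum_(i < k) phi i x) / k%:R + q) @[k --> \oo])).
  (* At [k = 0] the two sides are 0 and [q], because division by 0 gives 0; they agree from 1 on. *)
  apply: near_eq_cvg; exists 1%N => // k /= k0.
  rewrite /phi sumrB sumr_const card_ord mulrBl.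
  rewrite -[q *+ k]mulr_natr mulfK ?subrK//.
  by rewrite pnatr_eq0 -lt0n.
by apply: cvgD => //; exact: cvg_cst.
Qed.

(** The exceptional points carry a letter of weight 0 at [n]; they form a rectangle whose measure is
    a sum of zeros. *)
Lemma coord_support n : is_probability_vector p ->
  {ae mu, forall x : fullshift D, 0 < p (x n)}.
Proof.
move=> [p0 _].
have := hmu [:: n] (fun=> [set d | p d == 0]%SET) isT.
rewrite big_seq1 big1; last by move=> d; rewrite inE => /eqP.
move=> null; exists [set x : fullshift D | p (x n) = 0]; split.
- exact: (@measurable_coord D n [set d | p d = 0]).
- rewrite -[RHS]null; congr (mu _); apply/seteqP; split=> x /=.
    by move=> xn m; rewrite inE => /eqP ->; rewrite inE xn.
  by move=> /(_ n); rewrite !inE eqxx => /(_ isT) /eqP.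
- by move=> x /= /negP; rewrite -leNgt => xn; apply/eqP; rewrite eq_le xn p0.
Qed.

Lemma mu_cylinder_gt0 k (x : fullshift D) :
  is_probability_vector p ->
  (forall n : nat, 0 < p (x n%:Z)) -> (0 < mu (cylinder k x))%E.
Proof.
move=> [p0 _] px.
have := hmu [seq i%:Z | i <- iota 0 k] (fun n => [set x n]%SET).
rewrite map_inj_uniq ?iota_uniq; last by move=> i j [].
move=> /(_ isT); rewrite (_ : [set y | _] = cylinder k x); last first.
  apply/seteqP; split=> y.
    move=> H; apply/cylinderP => i ik; have := H i%:Z.
    by rewrite inE map_f ?mem_iota// => /(_ isT) /eqP.
  move=> /cylinderP H n /mapP[j]; rewrite mem_iota => jk ->.
  by rewrite inE H.
move=> ->; rewrite lte_fin big_map; apply: prodr_gt0 => i _.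
by rewrite big_set1.
Qed.
End Words.

(** * Uniform approximation by functions of finitely many coordinates *)

Section LocalApproximation.
Context {D : pfinType}.

(* Only the coordinates in [-M, M] are meaningful: [absz] folds those below [-M]
   back into the word. *)
Definition word_ext (M : nat) (w : seq D) : fullshift D :=
  fun n => nth point w (absz (n + M%:Z)).

Definition word_of (M : nat) (x : fullshift D) : (M.*2.+1).-tuple D :=
  [tuple x (i%:Z - M%:Z) | i < M.*2.+1].

(** Exactly one word matches [x] on [-M, M], so the agreement classes of the word extensions
    partition the space into finitely many pieces. *)
Lemma agree_word_ext M (w : (M.*2.+1).-tuple D) x :
  agree M (word_ext M w) x <-> w = word_of M x.
Proof.
split=> [H|-> n nM].
  apply: eq_from_tnth => i; rewrite tnth_mktuple -H; last first.
    by have := ltn_ord i; lia.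
  by rewrite /word_ext subrK /= (tnth_nth point).
have nM' : (absz (n + M%:Z)%R < M.*2.+1)%N by lia.
rewrite /word_ext -[absz _]/(nat_of_ord (Ordinal nM')) -tnth_nth tnth_mktuple.
by congr (x _) => /=; lia.
Qed.

(** Only the word read off [y] contributes to the sum, and it contributes the value of [u] at a
    point agreeing with [y] on the window. *)
Lemma local_approximation {R : realType} (u : fullshift D -> R) M e :
  (forall x y, agree M x y -> `|u x - u y| <= e) ->
  forall y, `|u y - \sum_(w : (M.*2.+1).-tuple D)
    u (word_ext M w) * \1_(agree M (word_ext M w)) y| <= e.
Proof.
move=> ue y; rewrite (bigD1 (word_of M y))//= big1 ?addr0.
  have H : agree M (word_ext M (word_of M y)) y by exact/agree_word_ext.
  rewrite indicE mem_set// mulr1; apply: ue; exact: agree_sym.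
move=> w wy; rewrite indicE memNset ?mulr0// => /agree_word_ext wE.
by rewrite wE eqxx in wy.
Qed.

End LocalApproximation.

(** * Birkhoff averages of real functions, at a point and over cylinders *)

Section RealAverages.
Context {R : realType} {D : pfinType} (mu : probability (borel_fullshift D) R).
Implicit Types (x y : fullshift D) (u : fullshift D -> R).

(** Words of each length form a finite type, so this is a countable conjunction and can hold almost
    everywhere as soon as each instance does. *)
Definition frequencies_converge x : Prop := forall M (w : (M.*2.+1).-tuple D),
  (\sum_(i < k) \1_(agree M (word_ext M w)) (iter i left_shift x)) / k%:R
    @[k --> \oo] --> fine (mu (agree M (word_ext M w))).

Definition mean k u x := k%:R^-1 * \sum_(i < k) u (iter i left_shift x).

Let continuous_bm u :
  continuous u -> bounded_measurable _ (borel_fullshift D) R u.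
Proof.
move=> cu; split; first exact: continuous_borel_measurable.
by have [B _ uB] := continuous_fullshift_bounded u cu; exists B.
Qed.

Let continuous_comp_shift u i : continuous u ->
  continuous (fun x => u (iter i left_shift x)).
Proof.
move=> cu x; apply: continuous_comp; last exact: cu.
exact: continuous_iter_left_shift.
Qed.

(** Replacing [u] by its local approximation [g] costs [e / 3] in the average and [e / 3] in the
    integral; for [g], the claim is a finite linear combination of word frequencies. *)
Lemma mean_cvg x u : frequencies_converge x -> continuous u ->
  mean k u x @[k --> \oo] --> \int[mu]_y u y.
Proof.
move=> fx cu; apply/cvgrPdist_le => e e0.
have e3 : 0 < e / 3 by rewrite divr_gt0.
have [M ue] := continuous_fullshift_unif u (e / 3) cu e3.
pose g y := \sum_(w : (M.*2.+1).-tuple D)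
    u (word_ext M w) * \1_(agree M (word_ext M w)) y.
have ug y : `|u y - g y| <= e / 3 by exact: local_approximation.
have bind w : bounded_measurable _ (borel_fullshift D) R
    (\1_(agree M (word_ext M w))).
  by apply: bounded_measurable_indic; exact: measurable_agree.
have bg : bounded_measurable _ (borel_fullshift D) R g.
  apply: bounded_measurable_sum => w.
  by apply: bounded_measurableM => //; exact: bounded_measurable_cst.
have intg : \int[mu]_y g y = \sum_(w : (M.*2.+1).-tuple D)
    u (word_ext M w) * fine (mu (agree M (word_ext M w))).
  rewrite Rintegral_sum//; last first.
    move=> w; apply: bounded_measurableM => //.
    exact: bounded_measurable_cst.
  apply: eq_bigr => w _; rewrite RintegralZl//; last first.
    exact: bounded_measurable_integrable.
  rewrite [in LHS]/Rintegral integral_indic// ?setIT//; exact: measurable_agree.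
have gcvg : mean k g x @[k --> \oo] --> \int[mu]_y g y.
  rewrite intg.
  have -> : (fun k => mean k g x) = (fun k => \sum_(w : (M.*2.+1).-tuple D)
      u (word_ext M w) *
      ((\sum_(i < k) \1_(agree M (word_ext M w)) (iter i left_shift x))
        / k%:R)).
    apply/funext => k; rewrite /mean exchange_big/= mulr_sumr.
    apply: eq_bigr => w _; rewrite -mulr_sumr; ring.
  apply: cvg_big => [|w _]; first exact: add_continuous.
  by apply: cvgM; [exact: cvg_cst|exact: fx].
have ig : `|\int[mu]_y u y - \int[mu]_y g y| <= e / 3.
  have iu : mu.-integrable setT (EFin \o u).
    by apply: bounded_measurable_integrable => //; exact: continuous_bm.
  have ig : mu.-integrable setT (EFin \o g).
    exact: bounded_measurable_integrable.
  have iug : mu.-integrable setT (EFin \o (fun y => u y - g y)).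
    apply: bounded_measurable_integrable => //.
    by apply: bounded_measurableB => //; exact: continuous_bm.
  rewrite -RintegralB// (le_trans (le_normr_Rintegral _ _))//.
  apply: (@le_trans _ _ (\int[mu]_y (e / 3))).
    apply: le_Rintegral => //.
    - exact: integrable_norm.
    - apply: bounded_measurable_integrable => //.
      exact: bounded_measurable_cst.
  by rewrite Rintegral_cst//= probability_setT mulr1.
have mg k : `|mean k g x - mean k u x| <= e / 3.
  rewrite distrC /mean -mulrBr -sumrB normrM.
  have [->|k0] := posnP k; first by rewrite invr0 normr0 mul0r ltW.
  rewrite ger0_norm ?invr_ge0// mulrC ler_pdivrMr ?ltr0n//.
  rewrite (le_trans (ler_norm_sum _ _ _))//.
  rewrite (le_trans (ler_sum _ (fun i _ => ug _)))//.
  by rewrite sumr_const card_ord mulr_natr.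
move/cvgrPdist_le : gcvg => /(_ _ e3); apply: filterS => k gk.
rewrite -(subrKA (\int[mu]_y g y)) (le_trans (ler_normD _ _))//.
rewrite -[X in _ + `|X|](subrKA (mean k g x)).
have := ler_normD (\int[mu]_y g y - mean k g x) (mean k g x - mean k u x).
have := mg k; lra.
Qed.

Lemma card_boundary_le M k :
  (\sum_(i < k | (i < M)%N || (k <= i + M)%N) 1 <= M.*2)%N.
Proof.
rewrite -(big_mkord (fun i => (i < M)%N || (k <= i + M)%N) (fun=> 1%N)).
rewrite sum1_count -size_filter.
apply: (@leq_trans (size (iota 0 M ++ iota (k - M) M))); last first.
  by rewrite size_cat !size_iota addnn.
apply: uniq_leq_size; first by rewrite filter_uniq// iota_uniq.
by move=> j; rewrite mem_filter mem_cat !mem_iota => /andP[/orP[]]; lia.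
Qed.

(** When [i-M, i+M] lies within [0, k), the shifted points agree on the window and the terms differ
    by at most [e]. At most [2M] indices remain, each costing at most [2 * B]. *)
Lemma mean_oscillation_le M k e B u x y : 0 <= e -> (0 < k)%N ->
  (forall x y, agree M x y -> `|u x - u y| <= e) ->
  (forall x, `|u x| <= B) -> cylinder k x y ->
  `|mean k u y - mean k u x| <= e + (4 * M%:R * B) / k%:R.
Proof.
move=> e0 k0 ue uB /cylinderP xy.
have B0 : 0 <= B by apply: le_trans (uB x).
rewrite /mean -mulrBr -sumrB normrM ger0_norm ?invr_ge0//.
rewrite mulrC ler_pdivrMr ?ltr0n// mulrDl mulfVK ?pnatr_eq0 -?lt0n//.
rewrite (le_trans (ler_norm_sum _ _ _))//.
apply: (@le_trans _ _ (\sum_(i < k)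
   (e + if (i < M)%N || (k <= i + M)%N then 2 * B else 0))).
  apply: ler_sum => i _; case: ifPn => [_|].
    rewrite (le_trans (ler_normB _ _))//.
    have := uB (iter i left_shift x); have := uB (iter i left_shift y); lra.
  rewrite negb_or -leqNgt -ltnNge => /andP[Mi iM].
  rewrite addr0; apply: ue => n nM; rewrite !iter_left_shift.
  (* [n + i] is nonnegative since [M <= i], so it is one of the natural coordinates fixed by the
     cylinder. *)
  have -> : n + i%:Z = (absz (n + i%:Z)%R)%:Z by lia.
  by apply: xy; lia.
rewrite big_split/= sumr_const card_ord -[e *+ k]mulr_natr lerD2l.
rewrite -big_mkcond/= sumr_const.
have := card_boundary_le M k; rewrite sum1_card => h.
rewrite -[leLHS]mulr_natr.
apply: (@le_trans _ _ (2 * B * (M.*2)%:R)).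
  by apply: ler_wpM2l; [rewrite mulr_ge0|rewrite ler_nat].
by rewrite -muln2 natrM; lra.
Qed.

Lemma measurable_cylinder k x :
  measurable (cylinder k x : set (borel_fullshift D)).
Proof.
apply: sub_sigma_algebra; rewrite openE => y /cylinderP xy.
apply/nbhs_fullshiftP; exists k => z yz; apply/cylinderP => i ik.
by rewrite -xy// yz//=; lia.
Qed.

Lemma mean_continuous k u : continuous u -> continuous (mean k u).
Proof.
move=> cu x.
have sumc : \sum_(i < k) u (iter i left_shift y) @[y --> x] -->
    \sum_(i < k) u (iter i left_shift x).
  apply: (@cvg_big R 'I_k +%R 0 xpredT (@add_continuous R) _ (nbhs x)).
  by move=> i _; exact: continuous_comp_shift.
exact: (cvgM (cvg_cst (k%:R^-1 : R)) sumc).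
Qed.

(** The oscillation bound shows that averaging over the cylinder changes the Birkhoff average at [x]
    by o(1), and the latter converges. *)
Lemma local_mean_cvg x u : (forall k, (0 < mu (cylinder k x))%E) ->
  frequencies_converge x -> continuous u ->
  (fine (mu (cylinder k x)))^-1 * \int[mu]_(y in cylinder k x) mean k u y
    @[k --> \oo] --> \int[mu]_y u y.
Proof.
move=> mux fx cu.
suff d0 : (fine (mu (cylinder k x)))^-1 *
      (\int[mu]_(y in cylinder k x) mean k u y) - mean k u x @[k --> \oo] --> 0.
  have := cvgD d0 (mean_cvg x u fx cu); rewrite add0r => h.
  apply: (cvg_trans _ (h _)); apply: near_eq_cvg.
  by exists 0%N => // k _; rewrite /= addrfctE subrK.
have [B B0 uB] := continuous_fullshift_bounded u cu.
apply/cvgrPdist_le => e e0.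
have e2 : 0 < e / 2 by rewrite divr_gt0.
have [M ue] := continuous_fullshift_unif u (e / 2) cu e2.
pose K := 4 * M%:R * B.
(* From here on the boundary contribution [K / k] is at most [e / 2]; the successor also forces
   [k > 0]. *)
exists (Num.truncn (K / (e / 2))).+1 => // k /= Kk.
have k0 : (0 < k)%N by exact: leq_ltn_trans Kk.
have {}Kk : K / k%:R <= e / 2.
  rewrite ler_pdivrMr ?ltr0n// mulrC -ler_pdivrMr//.
  by apply: ltW; apply: (lt_le_trans (truncnS_gt _)); rewrite ler_nat.
have osc y : cylinder k x y -> `|mean k u y - mean k u x| <= e.
  move=> xy.
  have := mean_oscillation_le _ _ _ _ _ _ _ (ltW e2) k0 ue uB xy.
  move=> /le_trans; apply.
  by rewrite -/K; lra.
have mC := measurable_cylinder k x.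
set C := cylinder k x in osc mC *.
have finC : mu C \is a fin_num by exact: fin_num_measure.
have muC : 0 < fine (mu C) by rewrite fine_gt0// mux ltey_eq finC.
have im : mu.-integrable C (EFin \o mean k u).
  apply: bounded_measurable_integrable => //.
  exact/continuous_bm/mean_continuous.
have ic c : mu.-integrable C (EFin \o (fun=> c : R)).
  by apply: bounded_measurable_integrable => //; exact: bounded_measurable_cst.
(* The constant [mean k u x] is written as its own average over [C], so that the difference becomes
   one integral to which [osc] applies. *)
rewrite sub0r normrN -[mean k u x](mulKf (lt0r_neq0 muC)) -mulrBr.
rewrite [fine _ * _]mulrC -Rintegral_cst// -RintegralB// normrM.
rewrite gtr0_norm ?invr_gt0// mulrC ler_pdivrMr//.
have ib : mu.-integrable C (EFin \o (fun y => mean k u y - mean k u x)).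
  apply: bounded_measurable_integrable => //.
  apply: bounded_measurableB; last exact: bounded_measurable_cst.
  exact/continuous_bm/mean_continuous.
rewrite (le_trans (le_normr_Rintegral _ _))// -Rintegral_cst//.
by apply: le_Rintegral => //; exact: integrable_norm.
Qed.

End RealAverages.

(** * Convergence and continuity in the complex plane through real and imaginary parts *)

Section ComplexTopology.
Context {R : realType}.
Implicit Types z w : R[i].

Lemma normc_ge_Im z : `|complex.Im z|%:C%C <= `|z|.
Proof.
rewrite normc_def lecR -sqrtr_sqr ler_wsqrtr//.
by rewrite lerDr sqr_ge0.
Qed.

Lemma normc_le_Re_Im z :
  `|z| <= (`|complex.Re z| + `|complex.Im z|)%:C%C.
Proof.
rewrite normc_def lecR -[leRHS]ger0_norm ?addr_ge0// -sqrtr_sqr ler_wsqrtr//.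
by rewrite sqrrD !real_normK ?num_real// lerD2r lerDl mulrn_wge0// mulr_ge0.
Qed.

Lemma cvg_Complex (a b : nat -> R) (x y : R) :
  a @ \oo --> x -> b @ \oo --> y ->
  (Complex (a k) (b k) : Cplx R) @[k --> \oo] --> (Complex x y : Cplx R).
Proof.
move=> /cvgrPdist_lt ax /cvgrPdist_lt yb; apply/cvgrPdist_lt => -[e i] e0.
(* The radius is itself a complex number; in the order on [R[i]], being positive forces it to be
   real. *)
have [i0 {}e0] : i = 0 /\ 0 < e by move: e0; rewrite ltcE/= => /andP[/eqP].
have e2 : 0 < e / 2 by rewrite divr_gt0.
apply: filterS2 (ax _ e2) (yb _ e2) => k axk ybk.
apply: (le_lt_trans (normc_le_Re_Im _)).
by rewrite i0 ltcR/=; lra.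
Qed.

Lemma Re_continuous : continuous (@complex.Re R : Cplx R -> R).
Proof.
move=> z.
have zF : Filter (nbhs (z : Cplx R)) := nbhs_filter z.
apply/(@cvgrPdist_lt _ _ _ _ zF) => e e0.
have e0' : 0 < e%:C%C by rewrite ltcR.
have := @nbhsx_ballx _ (Cplx R) z _ e0'; rewrite -ball_normE.
apply: (@filterS _ (nbhs z)) => w zw; rewrite -ltcR; apply: le_lt_trans zw.
by have := normc_ge_Re ((z : R[i]) - w); case: (z) (w) => [? ?] [? ?].
Qed.

Lemma Im_continuous : continuous (@complex.Im R : Cplx R -> R).
Proof.
move=> z.
have zF : Filter (nbhs (z : Cplx R)) := nbhs_filter z.
apply/(@cvgrPdist_lt _ _ _ _ zF) => e e0.
have e0' : 0 < e%:C%C by rewrite ltcR.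
have := @nbhsx_ballx _ (Cplx R) z _ e0'; rewrite -ball_normE.
apply: (@filterS _ (nbhs z)) => w zw; rewrite -ltcR; apply: le_lt_trans zw.
by have := normc_ge_Im ((z : R[i]) - w); case: (z) (w) => [? ?] [? ?].
Qed.

Lemma mul_real_Complex (c a b : R) :
  (Complex c 0 * Complex a b : R[i]) = Complex (c * a) (c * b).
Proof. by apply/eqP; rewrite eq_complex/= !mul0r subr0 addr0 !eqxx. Qed.

Lemma inv_real_Complex (c : R) : (Complex c 0 : R[i])^-1 = Complex c^-1 0.
Proof. by rewrite -[LHS]/((c%:C)%C^-1) -fmorphV. Qed.

End ComplexTopology.

(** * Reduction of complex averages to real ones, and the conclusion *)

Section ComplexAverages.
Context {R : realType} {D : pfinType} (mu : probability (borel_fullshift D) R).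

Lemma birkhoff_averageE k (f : fullshift D -> Cplx R) x :
  birkhoff_average k f x =
  Complex (mean k (fun y => complex.Re (f y)) x)
          (mean k (fun y => complex.Im (f y)) x).
Proof.
have sumE : forall (F : nat -> R[i]), \sum_(i < k) F i =
    Complex (\sum_(i < k) complex.Re (F i)) (\sum_(i < k) complex.Im (F i)).
  move=> F; elim: k => [|k IH]; first by rewrite !big_ord0.
  by rewrite !big_ord_recr/= IH; case: (F k).
rewrite /birkhoff_average [X in _ * X](sumE (fun i => f (iter i left_shift x))).
have -> : (k%:R : Cplx R) = Complex k%:R 0.
  exact: (esym (rmorph_nat (real_complex R) k)).
by rewrite [X in X * _]inv_real_Complex [LHS]mul_real_Complex.
Qed.

Lemma alpha_birkhoffE k (F : set (fullshift D)) (f : fullshift D -> Cplx R) :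
  alpha mu F (birkhoff_average k f) =
  Complex ((fine (mu F))^-1 *
            \int[mu]_(y in F) mean k (fun x => complex.Re (f x)) y)
          ((fine (mu F))^-1 *
            \int[mu]_(y in F) mean k (fun x => complex.Im (f x)) y).
Proof.
rewrite /alpha /Cintegral [X in X * _]inv_real_Complex [LHS]mul_real_Complex.
by congr (Complex (_ * _) (_ * _)); apply: eq_Rintegral => y _;
  rewrite birkhoff_averageE.
Qed.

End ComplexAverages.

Theorem proposition4p2 (R : realType) (D : pfinType) (p : D -> R)
    (mu : probability (borel_fullshift D) R)
    (hp : is_probability_vector p) (hmu : is_bernoulli_measure p mu) :
  {ae mu, forall x : fullshift D,
    (forall k : nat, (0 < mu (cylinder k x))%E) /\
    (forall f : fullshift D -> Cplx R, continuous f ->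
      alpha mu (cylinder k x) (birkhoff_average k f) @[k --> \oo]
        --> Cintegral mu setT f)}.
Proof.
have support : {ae mu, forall x : fullshift D, forall n : nat, 0 < p (x n%:Z)}.
  by apply/ae_foralln => n; exact: coord_support.
(* The exceptional set must not depend on [f]: it is a union of null sets, countable over [M] and
   finite over the words [w], chosen before [f] is introduced. *)
have freq : {ae mu, forall x : fullshift D, frequencies_converge mu x}.
  apply/ae_foralln => M; apply: filter_forall => w.
  exact: (word_frequency p mu hmu M (word_ext M w)).
move: support freq; apply: (@filterS2 _ (almost_everywhere mu)) => x px fx.
have mux k : (0 < mu (cylinder k x))%E by exact: (mu_cylinder_gt0 p mu hmu).
split=> // f cf.
under eq_cvg do rewrite alpha_birkhoffE.
apply: cvg_Complex; apply: local_mean_cvg => // y.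
- by apply: (@continuous_comp _ _ _ f); [exact: cf|exact: Re_continuous].
- by apply: (@continuous_comp _ _ _ f); [exact: cf|exact: Im_continuous].
Qed.
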